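(* Let $w$ be absolutely continuous on $(0,1)$ with $w(0)=0$ and $$\int_0^1\frac{|w_r|^2}{r}\,dr<\infty.$$ Then $$\int_0^1\frac{|w|^2}{r}\,dr\le\frac14\int_0^1\frac{|w_r|^2}{r}\,dr.$$ The same estimate holds after integration in $z$: if $w=w(r,z)$ is such that, for almost every $z$ in an interval $Z\subset\mathbb R$, the function $r\mapsto w(r,z)$ is absolutely continuous on $(0,1)$ with $w(0,z)=0$ and $\int_0^1\frac{|w_r(r,z)|^2}{r}\,dr<\infty$, then $$\int_Z\int_0^1\frac{|w|^2}{r}\,dr\,dz\le\frac14\int_Z\int_0^1\frac{|w_r|^2}{r}\,dr\,dz.$$
   Context: $w_r$ denotes the derivative in $r$, and $w(0)=0$ means $\lim_{r\downarrow0}w(r)=0$. *)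

(* Defs.v *)
From HB Require Import structures.
From mathcomp Require Import all_boot all_order all_algebra.
From mathcomp Require Import all_classical all_reals all_analysis.
Set Implicit Arguments.
Unset Strict Implicit.
Unset Printing Implicit Defensive.
Import Order.TTheory GRing.Theory Num.Theory.
Import numFieldNormedType.Exports.
Local Open Scope classical_set_scope.
Local Open Scope ring_scope.

(* Absolute continuity of a function on an interval I (not assumed closed or
   bounded), in the epsilon-delta sense over finite families of nonoverlapping
   subintervals. The closed subintervals are required to lie in I because f is
   evaluated at their endpoints; only their interiors have to be disjoint. *)
Definition absolutely_continuous_on (R : realType) (I : interval R)
    (f : R -> R) : Prop :=
  forall e : R, 0 < e -> exists2 d : R, 0 < d &
    forall (n : nat) (a b : 'I_n -> R),
      (forall i, a i < b i /\ `[a i, b i] `<=` [set` I]) ->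
      trivIset setT (fun i => `]a i, b i[%classic) ->
      \sum_(i < n) (b i - a i) < d ->
      \sum_(i < n) `|f (b i) - f (a i)| < e.

(* Main.v *)
(* For almost all x in ]a, b[ an absolutely continuous f has a derivative f' x,
   and f b - f a is the integral of f' over ]a, b]: the total variation V of f
   and V + f are nondecreasing and absolutely continuous, so their
   Lebesgue-Stieltjes measures have a Radon-Nikodym density with respect to
   the Lebesgue measure, and Lebesgue differentiation identifies the difference
   of these densities with f'. With A the integral of |w'|^2 / r over ]0, 1[,
   Cauchy-Schwarz then gives |w r|^2 <= A r^2 / 2, whence the integral of
   |w|^2 / r is at most that of A r / 2, which is A / 4. *)
Require Import Defs.
From HB Require Import structures.
From mathcomp Require Import all_boot all_order all_algebra.
From mathcomp Require Import all_classical all_reals all_analysis.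
From mathcomp Require Import measurable_realfun ring lra.
Import Order.TTheory GRing.Theory Num.Theory.
Import numFieldNormedType.Exports.
Local Open Scope classical_set_scope.
Local Open Scope ring_scope.

(** * Absolute continuity over finite sequences of intervals, clamping and total variation *)

Section absolutely_continuous_seq.
Context {R : realType}.
Implicit Types (f g : R -> R) (s : seq (R * R)).

(* An element (x, y) of s stands for the interval [x, y]. *)
Definition nonoverlapping s :=
  all (fun p => p.1 <= p.2) s &&
  pairwise (fun p q => (p.2 <= q.1) || (q.2 <= p.1)) s.

Definition total_length s := \sum_(p <- s) (p.2 - p.1).

(* Degenerate intervals are allowed, so that the notion is stable under
   clamping. *)
Definition absolutely_continuous_seq f := forall e : R, 0 < e ->
  exists2 d : R, 0 < d & forall s, nonoverlapping s -> total_length s < d ->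
    \sum_(p <- s) `|f p.2 - f p.1| <= e.

Lemma absolutely_continuous_seqD f g : absolutely_continuous_seq f ->
  absolutely_continuous_seq g -> absolutely_continuous_seq (f \+ g).
Proof.
move=> acf acg e e0; have e20 : 0 < e / 2 by rewrite divr_gt0.
have [d1 d10 H1] := acf _ e20; have [d2 d20 H2] := acg _ e20.
exists (Num.min d1 d2) => [|s ns]; first by rewrite lt_min d10.
rewrite lt_min => /andP[s1 s2].
rewrite (splitr e) (le_trans _ (lerD (H1 _ ns s1) (H2 _ ns s2)))//.
rewrite -big_split/= ler_sum// => p _.
by rewrite opprD addrACA ler_normD.
Qed.

(** For a <= b, composing with [clamp a b] extends a function from [a, b] to the whole line by its
    endpoint values. *)
Definition clamp (a b x : R) := Num.max a (Num.min x b).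

Lemma clamp_itv a b x : a <= b -> a <= clamp a b x <= b.
Proof. by move=> ab; rewrite /clamp le_max lexx/= ge_max ab ge_min lexx orbT. Qed.

Lemma clamp_id a b x : a <= x <= b -> clamp a b x = x.
Proof. by rewrite /clamp => /andP[ax xb]; rewrite min_l// max_r. Qed.

Lemma clamp_le a b x y : x <= y -> clamp a b x <= clamp a b y.
Proof. by move=> xy; apply: le_max2 => //; apply: le_min2. Qed.

Lemma clamp_lip a b x y : x <= y ->
  clamp a b y - clamp a b x <= y - x.
Proof.
rewrite /clamp /Num.max /Num.min => xy.
by do !case: ifPn; rewrite -?leNgt => *; lra.
Qed.

Definition clamps a b s := [seq (clamp a b p.1, clamp a b p.2) | p <- s].

Lemma nonoverlapping_clamps a b s :
  nonoverlapping s -> nonoverlapping (clamps a b s).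
Proof.
move=> /andP[/allP le_s dis_s]; apply/andP; split.
  by apply/allP => _ /mapP[p ps ->]/=; exact/clamp_le/le_s.
rewrite pairwise_map; apply: sub_pairwise dis_s => p q /=.
by case/orP => /(clamp_le a b) ->; rewrite ?orbT.
Qed.

Lemma total_length_clamps a b s :
  nonoverlapping s -> total_length (clamps a b s) <= total_length s.
Proof.
move=> /andP[/allP le_s _]; rewrite /total_length big_map big_seq [leRHS]big_seq.
by apply: ler_sum => p /le_s; exact: clamp_lip.
Qed.

Lemma absolutely_continuous_seq_clamp f a b :
  absolutely_continuous_seq f -> absolutely_continuous_seq (f \o clamp a b).
Proof.
move=> acf e e0; have [d d0 H] := acf e e0; exists d => // s ns sd.
have := H _ (nonoverlapping_clamps a b s ns).
rewrite big_map; apply; exact: le_lt_trans (total_length_clamps a b s ns) sd.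
Qed.

(** Clamping moves a family of intervals into [a, b] without increasing its length. Intervals that
    become degenerate contribute nothing and are filtered out, since [absolutely_continuous_on]
    speaks of strict intervals only. *)
Lemma absolutely_continuous_on_clamp (I : interval R) f a b :
  absolutely_continuous_on I f -> a <= b -> `[a, b] `<=` [set` I] ->
  absolutely_continuous_seq (f \o clamp a b).
Proof.
move=> acf ab abI e e0; have [d d0 H] := acf _ e0; exists d => // s ns sd.
pose t := [seq p <- clamps a b s | p.1 < p.2].
have /andP[_ dis_t] := nonoverlapping_clamps a b s ns.
have {}dis_t : pairwise (fun p q => (p.2 <= q.1) || (q.2 <= p.1)) t.
  by rewrite pairwise_filter.
pose u (i : 'I_(size t)) := (nth (0, 0) t i).1.
pose v (i : 'I_(size t)) := (nth (0, 0) t i).2.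
have tE (F : R * R -> R) : (forall x, F (x, x) = 0) ->
    \sum_(p <- clamps a b s) F p = \sum_(i < size t) F (u i, v i).
  move=> F0; rewrite (bigID (fun p : R * R => p.1 < p.2))/= [X in _ + X]big_seq_cond.
  rewrite [X in _ + X]big1 ?addr0 => [|[x y]/= /andP[]].
    rewrite -big_filter (big_nth (0, 0)) big_mkord.
    by apply: eq_bigr => i _; rewrite /u /v; case: nth.
  have /andP[/allP le_s _] := nonoverlapping_clamps a b s ns.
  move=> /le_s/=; rewrite -leNgt => xy yx.
  by have -> : x = y by apply/le_anti/andP.
have -> : \sum_(p <- s) `|(f \o clamp a b) p.2 - (f \o clamp a b) p.1| =
    \sum_(i < size t) `|f (v i) - f (u i)|.
  rewrite -(tE (fun p => `|f p.2 - f p.1|)) => [|x/=]; last by rewrite subrr normr0.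
  by rewrite /clamps big_map.
apply/ltW/H.
- move=> i; have := mem_nth (0, 0) (ltn_ord i).
  rewrite mem_filter => /andP[uv /mapP[p _ E]]; split; first exact: uv.
  apply: subset_trans abI => x /=; rewrite /u /v E/= !in_itv/=.
  have /andP[ap _] := clamp_itv a b p.1 ab.
  have /andP[_ pb] := clamp_itv a b p.2 ab.
  by move=> /andP[xp px]; rewrite (le_trans ap xp) (le_trans px pb).
- have main (i j : 'I_(size t)) x : (i < j)%N ->
      `]u i, v i[%classic x -> `]u j, v j[%classic x -> False.
    rewrite /= !in_itv/= => ij /andP[ui vi] /andP[uj vj].
    have /(pairwiseP (0, 0))/(_ i j) := dis_t.
    rewrite !inE => /(_ (ltn_ord i) (ltn_ord j) ij) /orP[] h.
      by have := lt_trans (lt_le_trans vi h) uj; rewrite ltxx.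
    by have := lt_trans (lt_le_trans vj h) ui; rewrite ltxx.
  move=> i j _ _ [x [xi xj]]; apply/val_inj.
  by case: (ltngtP i j) => // /main h; exfalso; apply: (h x).
- rewrite -(tE (fun p => p.2 - p.1)) => [|x/=]; last by rewrite subrr.
  exact: le_lt_trans (total_length_clamps a b s ns) sd.
Qed.

(** Here [zip (x :: l) l] lists the consecutive intervals of a subdivision, which turns its
    variation into a sum over a nonoverlapping sequence. *)
Lemma variation_pieces f x y (l : seq R) : itv_partition x y l ->
  [/\ nonoverlapping (zip (x :: l) l),
    total_length (zip (x :: l) l) = y - x,
    variation x y f l = \sum_(p <- zip (x :: l) l) `|f p.2 - f p.1| &
    forall p, p \in zip (x :: l) l -> x <= p.1 /\ p.2 <= y].
Proof.
elim: l x => [x /itv_partition_nil ->|z l IH x xzl].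
  by split=> //=; rewrite /total_length ?big_nil ?subrr// /variation/= big_nil.
have [xz zl] : x < z /\ itv_partition z y l.
  by move: xzl => [/= /andP[? ?] ?]; split.
have [/andP[no1 no2] len var sub] := IH _ zl.
split.
- apply/andP; split; first by rewrite /= ltW.
  rewrite [zip _ _]/= pairwise_cons no2 andbT.
  by apply/allP => p /sub[zp _]/=; rewrite zp.
- by rewrite /total_length/= big_cons/= -/(total_length _) len addrC subrKA.
- by rewrite [zip _ _]/= big_cons/= -var /variation/= big_nat_recl//=.
- move=> p; rewrite inE => /orP[/eqP ->/=|/sub[zp py]].
    by split => //; exact: itv_partition_le zl.
  by split => //; rewrite (le_trans (ltW xz)).
Qed.

Lemma nonoverlapping_cat s1 s2 : nonoverlapping (s1 ++ s2) =
  [&& nonoverlapping s1, nonoverlapping s2 &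
    allrel (fun p q => (p.2 <= q.1) || (q.2 <= p.1)) s1 s2].
Proof.
rewrite /nonoverlapping all_cat pairwise_cat.
by case: all; case: all; case: allrel; case: pairwise; case: pairwise.
Qed.

Lemma total_length_cat s1 s2 :
  total_length (s1 ++ s2) = total_length s1 + total_length s2.
Proof. by rewrite /total_length big_cat. Qed.

(** Subdividing the intervals of a family keeps it nonoverlapping and preserves its length, so the
    bound e survives the supremum over subdivisions. *)
Lemma total_variation_sum_le f d e :
  (forall s, nonoverlapping s -> total_length s < d ->
    \sum_(p <- s) `|f p.2 - f p.1| <= e) ->
  forall s, nonoverlapping s -> total_length s < d ->
    (\sum_(p <- s) total_variation p.1 p.2 f <= e%:E)%E.
Proof.
move=> H s.
(* The suprema are taken one interval at a time: [t] collects the pieces of intervals already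
   subdivided, [s] the intervals still carrying their total variation. *)
suff: forall t, nonoverlapping (s ++ t) -> total_length (s ++ t) < d ->
    (\sum_(p <- s) total_variation p.1 p.2 f +
      (\sum_(p <- t) `|f p.2 - f p.1|)%:E <= e%:E)%E.
  by move=> /(_ [::]); rewrite cats0 big_nil adde0.
elim: s => [t nt td|[x y] s IH t nst std].
  by rewrite big_nil add0e lee_fin H.
move: nst; rewrite -cat1s -catA nonoverlapping_cat => /and3P[xy nst /allrelP dis].
have {}xy : x <= y by move: xy => /andP[/=]; rewrite andbT.
rewrite /= -cat1s total_length_cat /total_length big_seq1/= -/(total_length _) in std.
set S := \sum_(p <- s) total_variation p.1 p.2 f in IH *.
set T := \sum_(p <- t) _.
have S0 : (0 <= S)%E.
  rewrite /S big_seq sume_ge0// => p ps; rewrite total_variation_ge0//.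
  by move: nst => /andP[/allP/(_ p) + _]; rewrite mem_cat ps => /(_ isT).
have key l : itv_partition x y l -> (S + (variation x y f l + T)%:E <= e%:E)%E.
  move=> xyl; have [np len var sub] := variation_pieces f x y l xyl.
  rewrite var -big_cat/=; apply: IH.
    rewrite !nonoverlapping_cat np/=.
    move: nst; rewrite nonoverlapping_cat => /and3P[-> -> st]/=.
    rewrite allrel_catr st andbT.
    apply/andP; split; apply/allrelP => p q pP qP.
      have := dis (x, y) q; rewrite inE eqxx mem_cat qP orbT => /(_ isT isT)/=.
      have [xp py] := sub _ pP.
      by case/orP => h; rewrite ?(le_trans py h) ?(le_trans h xp) ?orbT.
    have := dis (x, y) p; rewrite inE eqxx mem_cat pP => /(_ isT isT)/=.
    have [xq qy] := sub _ qP.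
    by case/orP => h; rewrite ?(le_trans qy h) ?(le_trans h xq) ?orbT.
  move: std; rewrite !total_length_cat len => std.
  by rewrite addrCA.
(* One subdivision already shows that [S] is finite, so [S] can be moved across the inequality
   before passing to the supremum. *)
have [l0 xyl0] : exists l, itv_partition x y l.
  move: xy; rewrite le_eqVlt => /predU1P[->|xy].
    by exists [::]; split.
  by exists [:: y]; exact: itv_partition1.
have Sfin : S \is a fin_num.
  rewrite ge0_fin_numE// (@le_lt_trans _ _ (e - (variation x y f l0 + T))%:E)//.
    by rewrite EFinB leeBrDr// key.
  by rewrite ltry.
rewrite big_cons/= -/S -addeA -leeBrDr; last by rewrite fin_numD Sfin.
apply: ge_ereal_sup => _ [_ [l xyl <-] <-].
rewrite leeBrDr; last by rewrite fin_numD Sfin.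
by rewrite addeCA -EFinD key.
Qed.

(** With d chosen for e = 1, the total variation over any interval shorter than d is at most 1, and
    finitely many steps of length d / 2 exhaust [x, y]. *)
Lemma absolutely_continuous_total_variation_fin f x y :
  absolutely_continuous_seq f -> x <= y ->
  total_variation x y f \is a fin_num.
Proof.
move=> acf; have [d d0 H] := acf 1 ltr01.
have d20 : 0 < d / 2 by rewrite divr_gt0.
suff main n : forall z, x <= z -> z - x <= n%:R * (d / 2) ->
    (total_variation x z f < +oo)%E.
  move=> xy; rewrite ge0_fin_numE ?total_variation_ge0//.
  apply: (main (Num.bound ((y - x) / (d / 2)))) => //.
  rewrite -ler_pdivrMr// ltW//.
  by rewrite archi_boundP// divr_ge0 ?subr_ge0// ltW.
elim: n => [z xz|n IH z xz].
  rewrite mul0r subr_le0 => zx.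
  have -> : z = x by apply/le_anti; rewrite zx.
  by rewrite total_variationxx ltry.
rewrite -natr1 mulrDl mul1r => zx.
(* The last step [m, z] has length at most d / 2 < d; the maximum keeps it from going below x. *)
pose m := Num.max x (z - d / 2).
have xm : x <= m by rewrite le_max lexx.
have mz : m <= z by rewrite ge_max xz lerBlDr lerDl ltW.
rewrite (total_variationD f xm mz) lte_add_pinfty//.
  apply: IH => //; rewrite /m; case: (leP x (z - d / 2)) => _; first lra.
  by rewrite subrr mulr_ge0// ltW.
apply: le_lt_trans (ltry 1).
have := total_variation_sum_le f d 1 H [:: (m, z)].
rewrite big_seq1; apply.
  by rewrite /nonoverlapping/= mz.
rewrite /total_length big_seq1/= /m.
case: (leP x (z - d / 2)) => h; lra.
Qed.

(** By additivity, the increments of this function are total variations over clamped intervals, so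
    the d that serves f serves here too. *)
Lemma absolutely_continuous_total_variation f a b :
  absolutely_continuous_seq f -> a <= b ->
  absolutely_continuous_seq (fun x => fine (total_variation a (clamp a b x) f)).
Proof.
move=> acf ab e e0; have [d d0 H] := acf e e0; exists d => // s ns sd.
rewrite -lee_fin -sumEFin.
have -> : (\sum_(p <- s) `|fine (total_variation a (clamp a b p.2) f) -
     fine (total_variation a (clamp a b p.1) f)|%:E =
     \sum_(p <- clamps a b s) total_variation p.1 p.2 f)%E.
  rewrite /clamps big_map/= big_seq [RHS]big_seq; apply: eq_bigr => p ps.
  have /andP[/allP/(_ p ps) pp _] := ns.
  have /andP[ap _] := clamp_itv a b p.1 ab.
  have cp := clamp_le a b _ _ pp.
  rewrite (total_variationD f ap cp) fineD.
  - rewrite addrC addKr ger0_norm ?fineK//.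
      exact: absolutely_continuous_total_variation_fin.
    by rewrite fine_ge0// total_variation_ge0.
  - exact: absolutely_continuous_total_variation_fin.
  - exact: absolutely_continuous_total_variation_fin.
apply: (total_variation_sum_le _ _ _ H); first exact: nonoverlapping_clamps.
exact: le_lt_trans (total_length_clamps a b s ns) sd.
Qed.

Lemma absolutely_continuous_seq_continuous f :
  absolutely_continuous_seq f -> continuous f.
Proof.
move=> acf x; apply/cvgrPdist_le => e e0.
have [d d0 H] := acf e e0.
have main u v : u <= v -> `|v - u| < d -> `|f v - f u| <= e.
  move=> uv uvd; have := H [:: (u, v)]; rewrite /total_length !big_seq1/=; apply.
    by rewrite /nonoverlapping/= uv.
  exact: le_lt_trans (ler_norm _) uvd.
near=> t.
have tx : `|x - t| < d by near: t; exact: cvgr_dist_lt.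
by have [xt|/ltW tx'] := leP x t; [rewrite distrC main// distrC|exact: main].
Unshelve. all: by end_near. Qed.

End absolutely_continuous_seq.

(** * Lebesgue-Stieltjes measures dominated by the Lebesgue measure *)

Section lebesgue_stieltjes_absolutely_continuous.
Context {R : realType}.
Local Notation mu := (@lebesgue_measure R).
Local Notation ls := (@lebesgue_stieltjes_measure R).

Lemma lebesgue_stieltjes_measure_itv (g : cumulative R R) (u v : R) : u <= v ->
  ls g `]u, v] = (g v - g u)%:E.
Proof.
move=> uv; rewrite /lebesgue_stieltjes_measure /measure_extension.
rewrite measurable_mu_extE/=; last exact: is_ocitv.
by rewrite wlength_itv_bnd//; exact: cumulative_is_nondecreasing.
Qed.

Lemma itv_oc_disjoint (u v u' v' : R) : u < v -> u' < v' ->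
  `]u, v] `&` `]u', v'] = set0 -> (v <= u') || (v' <= u).
Proof.
move=> uv uv' dis; apply/negPn/negP; rewrite negb_or -!ltNge => /andP[u'v uv2].
(* If the intervals overlapped, the smaller right endpoint would lie in both. *)
suff : set0 (Num.min v v') by [].
by rewrite -dis; split; rewrite /= in_itv/= lt_min ge_min lexx ?orbT ?uv ?uv' ?u'v ?uv2.
Qed.

(** A set of the ring is a finite disjoint union of half-open intervals. The same sequence serves
    every g, which lets the measure of g be compared with the Lebesgue measure, the case g = id. *)
Lemma ring_ocitv_seq (B : set (SetRing.type (ocitv_type R))) :
  measurable B -> exists s : seq (R * R),
  nonoverlapping s /\ forall g : cumulative R R,
    ls g B = (\sum_(p <- s) (g p.2 - g p.1))%:E.
Proof.
move=> mB.
have [S [finS S0 tS mS BE]] : exists S : set (set R), [/\ finite_set S,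
    forall X, S X -> X !=set0, trivIset S id,
    forall X, X \in S -> ocitv X & B = \bigcup_(X in S) X].
  by have [S [? ? ? ? ?]] := SetRing.ring_finite_set mB; exists S.
have [S' SE] : exists s : seq (set R), S = [set` s] by exact/finite_seqP.
pose t := undup S'.
have {}SE : S = [set` t] by rewrite SE; apply/seteqP; split => X /=; rewrite mem_undup.
have /choice[P HP] : forall X : set R, exists p : R * R,
    X \in t -> p.1 < p.2 /\ X = `]p.1, p.2]%classic.
  move=> X; have [Xt|nXt] := boolP (X \in t); last by exists (0, 0).
  have SX : S X by rewrite SE.
  have /mS/ocitvP[X0|[p p12 ->]] := mem_set SX; last by exists p.
  by have [x] := S0 _ SX; rewrite X0.
exists [seq P X | X <- t]; split.
  apply/andP; split.
    by apply/allP => _ /mapP[X Xt ->]; have [/ltW] := HP _ Xt.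
  rewrite pairwise_map; have := undup_uniq S'; rewrite -/t uniq_pairwise.
  apply: (sub_in_pairwise (P := mem t)); last exact/allP.
  move=> X Y Xt Yt /= XY.
  have [X12 XE] := HP _ Xt; have [Y12 YE] := HP _ Yt.
  apply: itv_oc_disjoint => //; rewrite -XE -YE.
  by move/trivIsetP : tS; apply => //; rewrite SE.
move=> g; rewrite BE measure_fin_bigcup//; last first.
  by move=> X SX; apply: sub_sigma_algebra; apply: mS; rewrite inE.
rewrite SE -fsbig_seq ?undup_uniq// big_map -sumEFin big_seq [RHS]big_seq.
apply: eq_bigr => X Xt.
have [X12 XE] := HP _ Xt; transitivity (ls g `](P X).1, (P X).2]); first by congr (ls g _).
by rewrite lebesgue_stieltjes_measure_itv ?ltW.
Qed.

(** A null set is covered by half-open intervals of total length below d. Each finite partial union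
    has g-measure at most e by absolute continuity, and continuity from below extends this to the
    whole cover. *)
Lemma lebesgue_stieltjes_dominates (g : cumulative R R) :
  absolutely_continuous_seq g -> ls g `<< mu.
Proof.
move=> acg; apply/null_content_dominatesP => A mA A0.
apply/eqP; rewrite -measure_le0; apply/lee_addgt0Pr => e e0; rewrite add0e.
have [d d0 H] := acg e e0.
have : (mu A < d%:E)%E by rewrite A0 lte_fin.
move=> /ereal_inf_lt[_ [F [mF AF] <-]] Fd.
have mF' i : measurable (F i : set (measurableTypeR R)).
  by apply: sub_sigma_algebra; exact: mF.
have mB n : measurable (\big[setU/set0]_(i < n.+1) F i : set (measurableTypeR R)).
  by apply: bigsetU_measurable => i _; exact: mF'.
apply: (@le_trans _ _ (ls g (\bigcup_i F i))).
  by apply: le_measure => //; rewrite inE//; exact: bigcupT_measurable.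
have cB : ls g (\big[setU/set0]_(i < n.+1) F i) @[n --> \oo] -->
    ls g (\bigcup_n (\big[setU/set0]_(i < n.+1) F i)).
  apply: nondecreasing_cvg_mu => //; first exact: bigcupT_measurable.
  by move=> m n mn; apply/subsetPset; exact: subset_bigsetU.
rewrite bigcup_bigsetU_bigcup in cB.
rewrite -(cvg_lim _ cB)//; apply: lime_le; first by apply/cvg_ex; eexists; exact: cB.
apply: nearW => n.
have [|s [ns sE]] := ring_ocitv_seq (\big[setU/set0]_(i < n.+1) F i).
  apply: bigsetU_measurable => i _; apply: sub_gen_smallest; exact: mF.
rewrite sE lee_fin.
apply: (@le_trans _ _ (\sum_(p <- s) `|g p.2 - g p.1|)).
  by apply: ler_sum => p _; exact: ler_norm.
apply: H => //; rewrite -lte_fin; apply: le_lt_trans Fd.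
(* At g = id, the formula for [s] gives its total length. *)
have <- : mu (\big[setU/set0]_(i < n.+1) F i) = (total_length s)%:E := sE idfun.
apply: (@le_trans _ _ (\sum_(i < n.+1) mu (F i))).
  by apply: content_subadditive => //; exact: bigcup_measurable.
under eq_bigr => i _ do
  rewrite /mu /lebesgue_measure /lebesgue_stieltjes_measure /measure_extension
          measurable_mu_extE//.
rewrite -(big_mkord xpredT (fun i => wlength idfun (F i))).
by apply: nneseries_lim_ge => i _ _; exact: wlength_ge0.
Qed.

End lebesgue_stieltjes_absolutely_continuous.

(** * The fundamental theorem of calculus for absolutely continuous functions *)

Section absolutely_continuous_FTC.
Context {R : realType}.
Local Notation mu := (@lebesgue_measure R).

Lemma nondecreasing_absolutely_continuous_density (g : R -> R) (a b : R) :
  nondecreasing g -> absolutely_continuous_seq g ->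
  exists2 h : R -> R, mu.-integrable setT (EFin \o h) &
    forall x, a <= x <= b -> g x - g a = \int[mu]_(t in `]a, x]) h t.
Proof.
move=> ndg acg.
have rcg : right_continuous g.
  exact: right_continuousW (absolutely_continuous_seq_continuous g acg).
pose C := @isCumulative.Build R _ R g ndg rcg.
pose G : cumulative R R := HB.pack g C.
have domG := lebesgue_stieltjes_dominates G acg.
have [ab|ba] := leP a b; last first.
  exists (cst 0); first exact: integrable0.
  by move=> x /andP[ax xb]; have := lt_le_trans ba (le_trans ax xb); rewrite ltxx.
have mab : measurable (`]a, b]%classic : set (measurableTypeR R)) by [].
have Gab : (lebesgue_stieltjes_measure G `]a, b] < +oo)%E.
  by rewrite lebesgue_stieltjes_measure_itv// ltry.
(* Restricting to ]a, b] makes the measure finite, hence its density integrable on the whole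
   line. *)
pose nu : {finite_measure set (measurableTypeR R) -> \bar R} := mfrestr mab Gab.
have domnu : nu `<< mu.
  apply/null_content_dominatesP => A mA A0.
  move/null_content_dominatesP : domG; apply; first exact: measurableI.
  by apply/eqP; rewrite -measure_le0 -[leRHS]A0 measureIl.
have [h [h0 hfin hint hE]] := radon_nikodym_sigma_finite domnu.
have hh : EFin \o (fine \o h) = h by apply/funext => x /=; rewrite fineK.
exists (fine \o h); first by rewrite hh.
move=> x /andP[ax xb].
have -> : \int[mu]_(t in `]a, x]) (fine \o h) t = fine (nu `]a, x]%classic).
  rewrite hE//; congr fine; apply: eq_integral => t _ /=; rewrite fineK//.
rewrite /nu/= /mfrestr /mrestr setIidl; last first.
  by apply: subset_itvl; rewrite bnd_simp.
by rewrite lebesgue_stieltjes_measure_itv.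
Qed.

Lemma absolutely_continuous_FTC (f : R -> R) (a b : R) : a <= b ->
  absolutely_continuous_seq f ->
  exists h : R -> R, [/\ mu.-integrable setT (EFin \o h),
    f b - f a = \int[mu]_(t in `]a, b]) h t &
    {ae mu, forall x, x \in `]a, b[ -> derive1 f x = h x}].
Proof.
move=> ab acf.
pose V x := fine (total_variation a (clamp a b x) f).
have acV : absolutely_continuous_seq V.
  exact: absolutely_continuous_total_variation.
pose W := V \+ (f \o clamp a b).
have acW : absolutely_continuous_seq W.
  by apply: absolutely_continuous_seqD => //; exact: absolutely_continuous_seq_clamp.
have VB x y : x <= y ->
    V y - V x = fine (total_variation (clamp a b x) (clamp a b y) f).
  move=> xy; have /andP[ax _] := clamp_itv a b x ab.
  have cxy := clamp_le a b _ _ xy.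
  rewrite /V (total_variationD f ax cxy) fineD.
  - by rewrite addrC addKr.
  - exact: absolutely_continuous_total_variation_fin.
  - exact: absolutely_continuous_total_variation_fin.
(* This bound yields the monotonicity of both V and W; on [a, b], f is W - V. *)
have fV x y : x <= y -> `|f (clamp a b y) - f (clamp a b x)| <= V y - V x.
  move=> xy; have cxy := clamp_le a b _ _ xy.
  rewrite VB// -lee_fin fineK ?total_variation_ge//.
  exact: absolutely_continuous_total_variation_fin.
have ndV : nondecreasing V.
  by move=> x y xy; rewrite -subr_ge0; apply: le_trans (fV x y xy).
have ndW : nondecreasing W.
  move=> x y xy; rewrite /W/=; have := fV x y xy.
  by rewrite ler_norml => /andP[+ _]; lra.
have [h1 int1 E1] := nondecreasing_absolutely_continuous_density V a b ndV acV.
have [h2 int2 E2] := nondecreasing_absolutely_continuous_density W a b ndW acW.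
pose h := h2 \- h1.
have inth : mu.-integrable setT (EFin \o h).
  by rewrite (_ : EFin \o h = (EFin \o h2) \- (EFin \o h1))%E//; exact: integrableB.
have fE x : a <= x <= b -> f x - f a = \int[mu]_(t in `]a, x]) h t.
  move=> axb; rewrite /h RintegralB//.
  - rewrite -E1// -E2// /W/= !clamp_id ?lexx//; lra.
  - exact: integrableS int2.
  - exact: integrableS int1.
exists h; split => //; first by rewrite fE// lexx ab.
have loc : locally_integrable setT h.
  by apply: open_integrable_locally => //; exact: openT.
have inty y : mu.-integrable [set` Interval (BRight a) (BRight y)] (EFin \o h).
  exact: integrableS inth.
have := FTC1 inty loc; apply: filterS; first exact: (ae_filter_ringOfSetsType mu).
move=> x H; rewrite in_itv/= => /andP[ax xb].
have [|dF <-] := H.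
  exact: ax.
rewrite !derive1E; pose F0 y := \int[mu]_(t in `]a, y]) h t; pose F := F0 \+ cst (f a).
(* Near an interior point f equals [F], the integral of h plus the constant f a, so both have the
   same derivative. *)
rewrite (near_eq_derive 1 (g := F)); last first.
  near=> y; rewrite /F/= /F0 -fE ?subrK//.
  have : y \in `]a, b[ by near: y; apply: near_in_itvoo; rewrite in_itv/= ax.
  by rewrite in_itv/= => /andP[/ltW -> /ltW ->].
by rewrite /F deriveD// derive_cst addr0.
Unshelve. all: by end_near. Qed.

End absolutely_continuous_FTC.

(** * Almost everywhere comparison of integrals of nonnegative functions *)

Section lower_integral.
Local Open Scope ereal_scope.
Import HBNNSimple.

(* Neither u nor v is assumed measurable: the integral of a nonnegative function
   is the supremum of the integrals of the simple functions below it. *)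
Lemma ge0_ae_le_integralZ d (T : measurableType d) (R : realType)
    (mu : {measure set T -> \bar R}) (D E : set T) (u v : T -> \bar R) (k : R) :
  (0 < k)%R -> D `<=` E ->
  (forall x, D x -> 0 <= u x) -> (forall x, E x -> 0 <= v x) ->
  {ae mu, forall x, D x -> u x <= k%:E * v x} ->
  \int[mu]_(x in D) u x <= k%:E * \int[mu]_(x in E) v x.
Proof.
move=> k0 DE u0 v0 [N [mN N0 uvN]].
have k'0 : (0 <= k^-1)%R by rewrite invr_ge0 ltW.
rewrite (ge0_integralE mu u0) (ge0_integralE mu v0).
apply: ge_ereal_sup => _ [h /= hu <-].
pose h1 := proj_nnsfun h (measurableC mN).
pose h2 := scale_nnsfun h1 k'0.
have h1E x : h1 x = (h x * \1_(~` N) x)%R by [].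
have -> : sintegral mu h = sintegral mu h1.
  rewrite -!integralT_nnsfun; apply: ae_eq_integral => //.
  - exact/measurable_EFinP.
  - exact/measurable_EFinP.
  - exists N; split => // x /= /not_implyP[_]; apply: contra_notP => nNx.
    by rewrite mindicE mem_set ?mulr1.
rewrite -lee_pdivrMl// -sintegralrM; apply: le_ereal_sup_tmp => /=.
exists (sintegral mu h2); last by [].
exists h2 => // x.
have vE0 : 0 <= (v \_ E) x by rewrite patchE; case: ifPn => //; rewrite inE => /v0.
have -> : h2 x = (k^-1 * h1 x)%R by [].
rewrite h1E indicE; have [Nx|nNx] := pselect (N x).
  by rewrite memNset ?mulr0// => /(_ Nx).
rewrite mem_set// mulr1 EFinM lee_pdivrMl//.
apply: le_trans (hu x) _; rewrite patchE; case: ifPn => [|_]; last first.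
  by rewrite mule_ge0// lee_fin ltW.
rewrite inE => Dx; rewrite patchE mem_set; last exact: DE.
by apply: contrapT => uv; apply: nNx; apply: uvN => /(_ Dx).
Qed.

End lower_integral.

Section hardy.
Context {R : realType}.
Local Notation mu := (@lebesgue_measure R).

Lemma integral_itvcc_linear (c a b : R) : a < b ->
  (\int[mu]_(x in `[a, b]) (c * x)%:E)%E = (c / 2 * (b ^+ 2 - a ^+ 2))%:E.
Proof.
move=> ab; pose F : R -> R := (c / 2) *: (id ^+ 2).
have dF (x : R) : is_derive x (1 : R) F (c * x).
  apply: is_derive_eq; rewrite /GRing.scale/= expr1; lra.
rewrite (@continuous_FTC2 _ _ F)//.
- by rewrite -EFinB /F/= /GRing.scale/= mulrBr.
- apply: continuous_subspaceT => x; apply: continuousM; first exact: cst_continuous.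
  exact: cvg_id.
- have cF : continuous F by move=> x; apply: differentiable_continuous; exact/derivable1_diffP.
  split => //.
  + exact/cvg_at_right_filter/cF.
  + exact/cvg_at_left_filter/cF.
- by move=> x _; rewrite derive1E derive_val.
Qed.

Lemma integral_increment_le (w : R -> R) (a b t A : R) :
  absolutely_continuous_on `]0, 1[ w -> 0 < a -> a < b -> b < 1 -> 0 < t ->
  (\int[mu]_(r in `]0%R, 1%R[) (`|derive1 w r| ^+ 2 / r)%:E = A%:E)%E ->
  `|w b - w a| <= t / 2 * A + (4 * t)^-1 * b ^+ 2.
Proof.
move=> acw a0 ab b1 t0 AE; have leab := ltW ab.
have acf : absolutely_continuous_seq (w \o clamp a b).
  apply: absolutely_continuous_on_clamp acw leab _ => x /=.
  by rewrite !in_itv/= => /andP[ax xb]; rewrite (lt_le_trans a0 ax) (le_lt_trans xb b1).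
have [h [inth hE h']] := absolutely_continuous_FTC _ a b leab acf.
pose l (s : R) := (2 * t)^-1 * s.
pose u (s : R) := Num.max 0 (`|h s| - l s).
have mh : measurable_fun setT h by move/integrableP : inth => [/measurable_EFinP].
have ml : measurable_fun setT l by exact: mulrl_measurable.
have mnh : measurable_fun setT (fun s => `|h s|) by exact: measurableT_comp.
have mu_ : measurable_fun setT u.
  by apply: measurable_maxr => //; exact: measurable_funB.
have uA : (\int[mu]_(s in `]a, b]) (u s)%:E <= (t / 2 * A)%:E)%E.
  rewrite -integral_itv_bndo_bndc; last exact/measurable_EFinP/measurable_funTS.
  rewrite EFinM -AE; apply: ge0_ae_le_integralZ.
  - by rewrite divr_gt0.
  - move=> x /=; rewrite !in_itv/= => /andP[ax xb].
    by rewrite (lt_trans a0 ax) (lt_trans xb b1).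
  - by move=> x _; rewrite lee_fin /u le_max lexx.
  - move=> x /=; rewrite in_itv/= => /andP[x0 _].
    by rewrite lee_fin divr_ge0 ?exprn_ge0// ltW.
  - move: h'; apply: filterS; first exact: (ae_filter_ringOfSetsType mu).
    move=> x hx /=; rewrite in_itv/= => /andP[ax xb].
    have x0 : 0 < x by exact: lt_trans ax.
    have <- : h x = derive1 w x.
      rewrite -hx ?in_itv/= ?ax//.
      rewrite !derive1E; apply: near_eq_derive; near=> y.
      have : y \in `]a, b[ by near: y; apply: near_in_itvoo; rewrite in_itv/= ax.
      by rewrite in_itv/= => /andP[/ltW ay /ltW yb]; rewrite /= clamp_id// ay.
    rewrite -EFinM lee_fin /u ge_max; apply/andP; split.
      by rewrite mulr_ge0 ?divr_ge0// ?exprn_ge0// ltW.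
    rewrite -subr_ge0 /l; set y := `|h x|.
    (* AM-GM: y <= t y^2 / (2 x) + x / (2 t) *)
    have -> : t / 2 * (y ^+ 2 / x) - (y - (2 * t)^-1 * x) =
        (t * y - x) ^+ 2 / (2 * t * x).
      by field; rewrite !gt_eqF.
    by rewrite divr_ge0 ?sqr_ge0// !mulr_ge0// ltW.
have fab : w b - w a = (w \o clamp a b) b - (w \o clamp a b) a.
  by rewrite /= !clamp_id ?lexx ?leab.
have intab : mu.-integrable `]a, b] (EFin \o h) by exact: integrableS inth.
rewrite fab hE -lee_fin; apply: (@le_trans _ _ (\int[mu]_(s in `]a, b]) `|h s|)%:E).
  by rewrite lee_fin le_normr_Rintegral.
rewrite fineK; last first.
  by apply: integrable_fin_num => //; exact: integrable_norm intab.
apply: (@le_trans _ _ (\int[mu]_(s in `]a, b]) ((u s)%:E + (l s)%:E))%E).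
  apply: ge0_le_integral => //=.
  - exact/measurable_EFinP/measurable_funTS.
  - by apply/measurable_funTS; apply: emeasurable_funD; exact/measurable_EFinP.
  - by move=> x _; rewrite -EFinD lee_fin -lerBlDr /u le_max lexx orbT.
rewrite ge0_integralD//; last 4 first.
- by move=> x _; rewrite lee_fin /u le_max lexx.
- exact/measurable_EFinP/measurable_funTS.
- move=> x /=; rewrite in_itv/= => /andP[ax _].
  by rewrite lee_fin mulr_ge0// ?invr_ge0 ?mulr_ge0// ltW// (lt_trans a0).
- exact/measurable_EFinP/measurable_funTS.
rewrite EFinD leeD//.
apply: (@le_trans _ _ (\int[mu]_(s in `[0%R, b]) (l s)%:E)%E).
  apply: ge0_subset_integral => //.
  - exact/measurable_EFinP/measurable_funTS.
  - move=> x /=; rewrite in_itv/= => /andP[x0 _].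
    by rewrite lee_fin mulr_ge0// invr_ge0 mulr_ge0// ltW.
  - by apply: subset_itvScc => //=; rewrite bnd_simp// ltW.
rewrite integral_itvcc_linear ?(lt_trans a0)// lee_fin expr0n/= subr0.
by rewrite !invfM; lra.
Unshelve. all: by end_near. Qed.

End hardy.

Section hardy_pointwise.
Context {R : realType}.
Local Notation mu := (@lebesgue_measure R).

Lemma normr_sqr_le_integral (w : R -> R) (b A : R) :
  absolutely_continuous_on `]0, 1[ w -> w r @[r --> 0^'+] --> 0 ->
  0 < b -> b < 1 ->
  (\int[mu]_(r in `]0%R, 1%R[) (`|derive1 w r| ^+ 2 / r)%:E = A%:E)%E ->
  `|w b| ^+ 2 <= b ^+ 2 * A / 2.
Proof.
move=> acw w0 b0 b1 AE.
have A0 : 0 <= A.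
  rewrite -lee_fin -AE; apply: integral_ge0 => r /=; rewrite in_itv/= => /andP[r0 _].
  by rewrite lee_fin divr_ge0 ?exprn_ge0// ltW.
have bound t : 0 < t -> `|w b| <= t / 2 * A + (4 * t)^-1 * b ^+ 2.
  move=> t0; apply/ler_addgt0Pr => e e0.
  near (0 : R)^'+ => a.
  have a0 : 0 < a by [].
  have ab : a < b by near: a; exact: nbhs_right_lt.
  have wa : `|w a| <= e.
    by near: a; have /cvgr0_norm_le := w0; exact.
  have := integral_increment_le w a b t A acw a0 ab b1 t0 AE.
  have : `|w b| <= `|w b - w a| + `|w a|.
    by rewrite -[X in `|X| <= _](subrK (w a)) ler_normD.
  lra.
have [->|wb0] := eqVneq (w b) 0.
  by rewrite normr0 expr0n/= divr_ge0// mulr_ge0// sqr_ge0.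
have y0 : 0 < `|w b| by rewrite normr_gt0.
set y := `|w b| in y0 bound *.
(* The bound is applied at t = y / A, or at t = b^2 / y when A = 0. *)
have [A00|A1] := eqVneq A 0.
  have /bound : 0 < b ^+ 2 / y by rewrite divr_gt0// exprn_gt0.
  have -> : (4 * (b ^+ 2 / y))^-1 * b ^+ 2 = y / 4.
    by field; rewrite !gt_eqF.
  by rewrite A00; lra.
have {A1}A1 : 0 < A by rewrite lt_neqAle eq_sym A1.
have /bound : 0 < y / A by rewrite divr_gt0.
have -> : y / A / 2 * A + (4 * (y / A))^-1 * b ^+ 2 =
    y / 2 + b ^+ 2 * A / (4 * y) by field; rewrite !gt_eqF.
move=> h; have : y / 2 <= b ^+ 2 * A / (4 * y) by lra.
rewrite ler_pdivlMr ?mulr_gt0//; lra.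
Unshelve. all: by end_near. Qed.

Lemma hardy_inequality (w : R -> R) :
  absolutely_continuous_on `]0, 1[ w -> w r @[r --> 0^'+] --> 0 ->
  (\int[mu]_(r in `]0%R, 1%R[) (`|derive1 w r| ^+ 2 / r)%:E < +oo)%E ->
  (\int[mu]_(r in `]0%R, 1%R[) (`|w r| ^+ 2 / r)%:E <= (1 / 4)%:E *
     \int[mu]_(r in `]0%R, 1%R[) (`|derive1 w r| ^+ 2 / r)%:E)%E.
Proof.
move=> acw w0; set I := (X in (X < _)%E) => Ioo.
have I0 : (0 <= I)%E.
  apply: integral_ge0 => r /=; rewrite in_itv/= => /andP[r0 _].
  by rewrite lee_fin divr_ge0 ?exprn_ge0// ltW.
have IE : I = (fine I)%:E by rewrite fineK// ge0_fin_numE.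
have A0 : 0 <= fine I by rewrite fine_ge0.
apply: (@le_trans _ _
    ((1 / 2)%:E * \int[mu]_(r in `[0%R, 1%R]) (fine I * r)%:E)%E).
  apply: ge0_ae_le_integralZ.
  - by [].
  - exact: subset_itv_oo_cc.
  - move=> r /=; rewrite in_itv/= => /andP[r0 _].
    by rewrite lee_fin divr_ge0 ?exprn_ge0// ltW.
  - by move=> r /=; rewrite in_itv/= => /andP[r0 _]; rewrite lee_fin mulr_ge0.
  - apply: aeW => r /=; rewrite in_itv/= => /andP[r0 r1].
    have := normr_sqr_le_integral w r (fine I) acw w0 r0 r1 IE.
    rewrite -EFinM lee_fin ler_pdivrMr//; lra.
rewrite integral_itvcc_linear//.
have -> : (\int[mu]_(r in `]0%R, 1%R[) (`|derive1 w r| ^+ 2 / r)%:E = (fine I)%:E)%E.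
  exact: IE.
by rewrite -!EFinM lee_fin expr1n expr0n/=; lra.
Qed.

End hardy_pointwise.

Theorem lemma4p2 (R : realType) :
  (forall w : R -> R,
     absolutely_continuous_on `]0, 1[ w ->
     w r @[r --> 0^'+] --> 0 ->
     (\int[lebesgue_measure]_(r in `]0%R, 1%R[) (`|derive1 w r| ^+ 2 / r)%:E
        < +oo)%E ->
     (\int[lebesgue_measure]_(r in `]0%R, 1%R[) (`|w r| ^+ 2 / r)%:E
        <= (1 / 4)%:E *
           \int[lebesgue_measure]_(r in `]0%R, 1%R[)
             (`|derive1 w r| ^+ 2 / r)%:E)%E)
  /\
  (forall (Z : interval R) (w : R -> R -> R),
     {ae lebesgue_measure, forall z : R, z \in Z ->
        [/\ absolutely_continuous_on `]0, 1[ (fun r => w r z),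
            w r z @[r --> 0^'+] --> 0 &
            (\int[lebesgue_measure]_(r in `]0%R, 1%R[)
               (`|derive1 (fun s => w s z) r| ^+ 2 / r)%:E < +oo)%E]} ->
     (\int[lebesgue_measure]_(z in [set` Z])
        \int[lebesgue_measure]_(r in `]0%R, 1%R[) (`|w r z| ^+ 2 / r)%:E
        <= (1 / 4)%:E *
           \int[lebesgue_measure]_(z in [set` Z])
             \int[lebesgue_measure]_(r in `]0%R, 1%R[)
               (`|derive1 (fun s => w s z) r| ^+ 2 / r)%:E)%E).
Proof.
split; first exact: hardy_inequality.
move=> Z w Hw; apply: ge0_ae_le_integralZ.
- by [].
- by [].
- move=> z _; apply: integral_ge0 => r /=; rewrite in_itv/= => /andP[r0 _].
  by rewrite lee_fin divr_ge0 ?exprn_ge0// ltW.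
- move=> z _; apply: integral_ge0 => r /=; rewrite in_itv/= => /andP[r0 _].
  by rewrite lee_fin divr_ge0 ?exprn_ge0// ltW.
- move: Hw; apply: filterS; first exact: (ae_filter_ringOfSetsType lebesgue_measure).
  by move=> z Hz /Hz[ac0 w0 fin]; exact: hardy_inequality.
Qed.
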